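(* Let $a,b\in\mathbb{Q}$. For every integer $n\ge 0$, the Hankel transform $(h_n)_{n\ge 0}$ of the sequence $(aC_{n+1}+bC_{n+2})_{n\ge 0}$ is given by $$h_n=\sum_{k=0}^{n+1}\binom{n+k+2}{2k+1}\,b^{\,n-k+1}a^k .$$
   Context: $C_n=\frac{1}{n+1}\binom{2n}{n}$ denotes the $n$-th Catalan number ($1,1,2,5,14,\ldots$). The Hankel transform of a sequence $(s_n)_{n\ge 0}$ is the sequence $(h_n)_{n\ge 0}$ with $h_n=\det(s_{i+j})_{0\le i,j\le n}$. By convention $0^0=1$. *)

(* Defs.v *)
From mathcomp Require Import all_boot all_order all_algebra.

Set Implicit Arguments.
Unset Strict Implicit.
Unset Printing Implicit Defensive.

Import GRing.Theory.
Local Open Scope ring_scope.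

(* Rational-valued, so that the division by n + 1 is exact. *)
Definition catalan (n : nat) : rat := (n.+1%:R)^-1 * 'C(2 * n, n)%:R.

(* The n-th term is a determinant of order n + 1. *)
Definition hankel_transform (R : comNzRingType) (s : nat -> R) (n : nat) : R :=
  \det (\matrix_(i < n.+1, j < n.+1) s (i + j)%N).

(* Main.v *)
Require Import Defs.
From mathcomp Require Import all_boot all_order all_algebra.
From mathcomp Require Import zify ring.

(** Up to a shift, the Catalan numbers are the moments of the infinite
    tridiagonal matrix [J] with diagonal entries [2] and off-diagonal entries
    [1]: the Catalan number of index [m + 1] is the corner entry of [J ^ m].
    Let [L] be the matrix whose row [i] is the first row of [J ^ i]; it has a
    closed form as a difference of binomials ([ballot]) and is lower
    unitriangular.  Since [J] is symmetric, the entry of the Hankel matrix at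
    [(i, j)], which is the corner of [J ^ i (a + b J) J ^ j], is that of
    [L (a + b J) L^T] ([ballot_gram]), and the triangular shape of [L] makes
    this factorisation survive truncation to order [n + 1].  The Hankel
    determinant is therefore the determinant of the truncation of [a + b J],
    a tridiagonal Toeplitz matrix whose determinants satisfy
    [D_(m+2) = (a + 2 b) D_(m+1) - b^2 D_m] ([det_tridiagSS]).  The binomial sum
    satisfies the same recurrence, by Pascal's rule ([binom_sumSS]). *)

Set Implicit Arguments.
Unset Strict Implicit.
Unset Printing Implicit Defensive.

Import GRing.Theory Num.Theory.
Local Open Scope ring_scope.

(** * Ballot numbers *)

(** This is the entry of [J ^ n] in row [0] and column [k].  The lower indices
    of the binomials are written as [n + k + 1] and not by their complements
    [n - k], so that the vanishing for [k > n] needs no truncated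
    subtraction. *)
Definition ballot (n k : nat) : rat :=
  'C(n.*2.+1, n + k.+1)%:R - 'C(n.*2.+1, n + k.+2)%:R.

Lemma ballot_small n k : (n < k)%N -> ballot n k = 0.
Proof. by move=> ltnk; rewrite /ballot !bin_small ?subrr //; lia. Qed.

Lemma ballot_diag n : ballot n n = 1.
Proof.
rewrite /ballot (_ : (n + n.+1 = n.*2.+1)%N); last by lia.
by rewrite binn bin_small ?subr0 //; lia.
Qed.

Lemma pascal2 (n m : nat) :
  'C(n.+2, m.+2)%:R = 'C(n, m.+2)%:R + 2 * 'C(n, m.+1)%:R + 'C(n, m)%:R :> rat.
Proof. by rewrite !binS !natrD; ring. Qed.

Lemma bin_central_sym n : 'C(n.*2.+1, n) = 'C(n.*2.+1, n.+1).
Proof. by rewrite -bin_sub; [congr 'C(_, _); lia | lia]. Qed.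

Lemma ballotSS n k :
  ballot n.+1 k.+1 = ballot n k + 2 * ballot n k.+1 + ballot n k.+2.
Proof.
by rewrite /ballot doubleS !addSn !addnS !pascal2; ring.
Qed.

(** The term with column index [-1] that the general recurrence would add is
    ['C(2n+1, n) - 'C(2n+1, n+1)], which vanishes by symmetry. *)
Lemma ballotS0 n : ballot n.+1 0 = 2 * ballot n 0 + ballot n 1.
Proof.
rewrite /ballot doubleS !addSn !addnS addn0 !pascal2 bin_central_sym; ring.
Qed.

Lemma ballot0_catalan n : ballot n 0 = catalan n.+1.
Proof.
rewrite /ballot /catalan addn1 addn2.
have -> : (2 * n.+1 = n.*2.+2)%N by lia.
rewrite (binS n.*2.+1 n) bin_central_sym natrD.
have /(congr1 (fun m => m%:R : rat)) := mul_bin_left n.*2.+1 n.+1.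
have -> : (n.*2.+1 - n.+1 = n)%N by lia.
rewrite !natrM => E.
have nz : n.+2%:R != 0 :> rat by rewrite pnatr_eq0.
apply: (mulfI nz); rewrite mulrA divff // mul1r mulrBr E.
by rewrite -[n.+2]addn2 natrD; ring.
Qed.

(** The self-adjointness of [J] up to a boundary term: applying [J] to row [i]
    or to row [j] gives scalar products whose difference telescopes to the
    discrete Wronskian of the two rows at the cut [N]. *)
Lemma ballot_wronskian i j N :
  \sum_(k < N.+1) (ballot i.+1 k * ballot j k - ballot i k * ballot j.+1 k) =
  ballot i N.+1 * ballot j N - ballot i N * ballot j N.+1.
Proof.
elim: N => [|N IHN]; first by rewrite big_ord1 !ballotS0; ring.
by rewrite big_ord_recr /= IHN !ballotSS; ring.
Qed.

(** Only [i] is bounded: row [i] vanishes from column [N] on, so the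
    truncated sum is the full scalar product of the rows [i] and [j]. *)
Lemma ballot_gram N i j :
  (i < N)%N -> \sum_(k < N) ballot i k * ballot j k = ballot (i + j) 0.
Proof.
case: N => // N; elim: i j => [|i IHi] j ltiN.
  rewrite big_ord_recl ballot_diag mul1r big1 ?addr0 // => k _.
  by rewrite ballot_small ?mul0r.
rewrite addSnnS -IHi 1?ltnW //; apply/eqP; rewrite -subr_eq0 -sumrB.
rewrite ballot_wronskian (@ballot_small i N) ?(@ballot_small i N.+1) //.
  by rewrite !mul0r subrr.
exact: ltnW.
Qed.

(** * Tridiagonal Toeplitz determinants *)

Section Tridiagonal.
Variable R : comNzRingType.

Definition tridiag_coef (c b : R) (i j : nat) : R :=
  if i == j then c else if (i == j.+1) || (j == i.+1) then b else 0.

Definition tridiag (c b : R) (n : nat) : 'M[R]_n :=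
  \matrix_(i, j) tridiag_coef c b i j.

(** Expansion along the first row, then along the first column of the minor
    that the entry [b] at [(0, 1)] leaves. *)
Lemma det_tridiagSS c b n :
  \det (tridiag c b n.+2) =
  c * \det (tridiag c b n.+1) - b ^+ 2 * \det (tridiag c b n).
Proof.
rewrite (expand_det_row _ ord0) !big_ord_recl big1 ?addr0; last first.
  by move=> j _; rewrite mxE mul0r.
rewrite /cofactor !mxE /= expr0 expr1 mul1r.
congr (c * _ + _).
  by congr (\det _); apply/matrixP => i j; rewrite !mxE.
rewrite (expand_det_col _ ord0) big_ord_recl big1 ?addr0; last first.
  by move=> i _; rewrite !mxE mul0r.
rewrite /cofactor !mxE /= expr0 mul1r.
rewrite (_ : \det _ = \det (tridiag c b n)); last first.
  by congr (\det _); apply/matrixP => i j; rewrite !mxE.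
by rewrite /tridiag_coef /=; ring.
Qed.

Lemma det_tridiag0 c b : \det (tridiag c b 0) = 1.
Proof. exact: det_mx00. Qed.

Lemma det_tridiag1 c b : \det (tridiag c b 1) = c.
Proof. by rewrite det_mx11 mxE. Qed.

End Tridiagonal.

(** * The binomial sum *)

Definition binom_sum (a b : rat) (m : nat) : rat :=
  \sum_(0 <= k < m.+1) 'C(m + k + 1, 2 * k + 1)%:R * b ^+ (m - k) * a ^+ k.

(** The added terms have a zero binomial; this brings the sums of different
    orders to a common range and a common total degree. *)
Lemma binom_sum_widen a b m d :
  b ^+ d * binom_sum a b m =
  \sum_(0 <= k < (m + d).+1)
    'C(m + k + 1, 2 * k + 1)%:R * b ^+ (m + d - k) * a ^+ k.
Proof.
rewrite /binom_sum (@big_cat_nat _ _ _ m.+1 0 (m + d).+1) //=; last by lia.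
rewrite [X in _ = _ + X]big_nat_cond [X in _ = _ + X]big1 ?addr0; last first.
  by move=> k lek; rewrite bin_small ?mul0r //; lia.
rewrite big_distrr /=; apply: eq_big_nat => k lek.
have -> : (m + d - k = d + (m - k))%N by lia.
by rewrite exprD; ring.
Qed.

(** Coefficientwise in [a], this is Pascal's rule applied twice. *)
Lemma binom_sumSS a b m :
  binom_sum a b m.+2 =
  (a + 2 * b) * binom_sum a b m.+1 - b ^+ 2 * binom_sum a b m.
Proof.
have bS := binom_sum_widen a b m.+1 1; rewrite expr1 addn1 in bS.
have b2S := binom_sum_widen a b m 2; rewrite addn2 in b2S.
rewrite mulrDl -mulrA bS b2S /binom_sum !(big_nat_recl m.+2 0) // big_distrr /=.
rewrite !subn0 !expr0 !muln0 !addn0 !bin1.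
have head_tail (A B C D E F G : rat) : A = 2 * C - E -> B = D + 2 * F - G ->
    A + B = D + 2 * (C + F) - (E + G) by move=> -> ->; ring.
apply: head_tail.
  by rewrite !addn1 -[m.+3]addn2 -[m.+2]addn1 -[m.+1]addn1 !natrD; ring.
rewrite big_distrr -big_split -sumrB /=; apply: eq_bigr => k _.
rewrite !subSS exprS.
have -> : (m.+2 + k.+1 + 1 = (m + k).+4)%N by lia.
have -> : (m.+1 + k.+1 + 1 = (m + k).+3)%N by lia.
have -> : (m.+1 + k + 1 = (m + k).+2)%N by lia.
have -> : (m + k.+1 + 1 = (m + k).+2)%N by lia.
have -> : (2 * k.+1 + 1 = (2 * k + 1).+2)%N by lia.
by rewrite addn1 !pascal2 !binS !natrD; ring.
Qed.

Lemma det_tridiag_binom_sum a b m :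
  \det (tridiag (a + 2 * b) b m) = binom_sum a b m.
Proof.
(* The recurrence has order two, so two consecutive ranks are carried. *)
suff [] : \det (tridiag (a + 2 * b) b m) = binom_sum a b m /\
          \det (tridiag (a + 2 * b) b m.+1) = binom_sum a b m.+1 by [].
elim: m => [|m [IH0 IH1]]; last first.
  by split=> //; rewrite det_tridiagSS binom_sumSS IH0 IH1.
split; first by rewrite det_tridiag0 /binom_sum big_nat1 /= mulr1 mulr1.
rewrite det_tridiag1 /binom_sum !big_nat_recr //= big_geq //.
by rewrite add0r; rewrite /binomial /=; ring.
Qed.

(** * Factorisation of the Hankel matrix *)

Definition ballot_mx (n : nat) : 'M[rat]_n := \matrix_(i, k) ballot i k.

Lemma det_ballot_mx n : \det (ballot_mx n) = 1.
Proof.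
rewrite det_trig; last first.
  by apply/is_trig_mxP => i j ltij; rewrite mxE ballot_small.
by rewrite big1 // => i _; rewrite mxE ballot_diag.
Qed.

(** Row [j] of [L] has its support in the first [n] columns, so the truncation
    of [a + b J] to order [n] acts on it exactly as [a + b J] does. *)
Lemma tridiag_ballot (a b : rat) n (k j : 'I_n) :
  \sum_(l < n) tridiag (a + 2 * b) b n k l * ballot j l =
  a * ballot j k + b * ballot j.+1 k.
Proof.
(* For [k = 0] the predecessor is [0] itself, hence the inner test. *)
have coefE l : tridiag_coef (a + 2 * b) b k l * ballot j l =
    (if l == k then (a + 2 * b) * ballot j l else 0) +
    (if l == k.+1 then b * ballot j l else 0) +
    (if l == k.-1 then if (0 < k)%N then b * ballot j l else 0 else 0).
  rewrite /tridiag_coef.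
  by do !case: ifPn => ?; rewrite ?mul0r ?addr0 ?add0r //; lia.
under eq_bigr => l _ do rewrite mxE coefE.
rewrite !big_split -!big_mkcond.
rewrite (big_ord1_eq _ (fun l => (a + 2 * b) * ballot j l)) ltn_ord.
rewrite (big_ord1_eq _ (fun l => b * ballot j l)).
rewrite (big_ord1_eq _ (fun l => if (0 < k)%N then b * ballot j l else 0)).
rewrite (leq_ltn_trans (leq_pred k) (ltn_ord k)).
(* At the cut [k.+1 = n] the lost term is zero because [j < n]. *)
have -> : (if (k.+1 < n)%N then b * ballot j k.+1 else 0) = b * ballot j k.+1.
  by case: ltnP => // /(leq_trans (ltn_ord j))/ballot_small->; rewrite mulr0.
by case: (k : nat) => [|k'] /=; rewrite ?ballotS0 ?ballotSS; ring.
Qed.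

(* The exponent n - k + 1 is written n.+1 - k because subtraction on nat is
   truncated and k may equal n + 1. *)
Theorem proposition8 (a b : rat) (n : nat) :
  hankel_transform (fun m : nat => a * catalan m.+1 + b * catalan m.+2) n =
  \sum_(0 <= k < n.+2)
     'C(n + k + 2, 2 * k + 1)%:R * b ^+ (n.+1 - k) * a ^+ k.
Proof.
rewrite /hankel_transform.
set L := ballot_mx n.+1; set T := tridiag (a + 2 * b) b n.+1.
have -> : \matrix_(i < n.+1, j < n.+1)
    (a * catalan (i + j).+1 + b * catalan (i + j).+2) = L *m (T *m L^T).
  apply/matrixP => i j; rewrite !mxE -!ballot0_catalan -addnS.
  rewrite -!(@ballot_gram n.+1 i) // !big_distrr -big_split /=.
  apply: eq_bigr => k _; rewrite [L i k]mxE [(T *m L^T) k j]mxE.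
  have -> : \sum_l T k l * L^T l j = a * ballot j k + b * ballot j.+1 k.
    by rewrite -tridiag_ballot; apply: eq_bigr => l _; rewrite !mxE.
  by ring.
rewrite !det_mulmx det_tr det_ballot_mx mul1r mulr1 det_tridiag_binom_sum.
by apply: eq_bigr => k _; congr ('C(_, _)%:R * _ * _); lia.
Qed.
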